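(* There is a constant $c$ such that the following holds. Let $w$ be a nontrivial element of the free group $F_2$ represented by a word of length $n$. Then there exists a prime $p\le c\,n$ such that $w$ is not in the kernel of the homomorphism $F_2\to \mathrm{SL}_2(\mathbb{Z}/p\mathbb{Z})$ which maps the two free generators of $F_2$ to $\begin{pmatrix}1&2\\0&1\end{pmatrix}$ and $\begin{pmatrix}1&0\\2&1\end{pmatrix}$ respectively.
   Context: Words are in the two free generators of $F_2$ and their inverses. *)

(* Defs.v *)
From HB Require Import structures.
From mathcomp Require Import all_boot all_order all_algebra all_fingroup.

Set Implicit Arguments.
Unset Strict Implicit.
Unset Printing Implicit Defensive.

Import GRing.Theory.

(* A letter (x, e) stands for the generator x if e = false and for its formal
   inverse if e = true. *)
Definition letter (X : Type) : Type := (X * bool)%type.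

Section Words.
Variable X : choiceType.
Implicit Types (a b : letter X) (s t u : seq (letter X)).

Definition linv a : letter X := (a.1, ~~ a.2).

Definition reduced s := sorted (fun a b => b != linv a) s.

Definition push a s :=
  if s is b :: s' then if b == linv a then s' else a :: s else [:: a].

Definition pushs s u := foldr push u s.

Definition reduce s := pushs s [::].

Definition winv s := rev (map linv s).

Lemma linvK : involutive linv.
Proof. by case=> x e; rewrite /linv /= negbK. Qed.

Lemma reduced_behead a s : reduced (a :: s) -> reduced s.
Proof. exact: path_sorted. Qed.

Lemma push_reduced a s : reduced s -> reduced (push a s).
Proof.
case: s => [|b s] //= Hs; case: eqP => [_|/eqP Hb]; last by rewrite /= Hb.
exact: reduced_behead Hs.
Qed.

Lemma pushs_reduced s u : reduced u -> reduced (pushs s u).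
Proof. by move=> Hu; elim: s => //= a s; apply: push_reduced. Qed.

Lemma reduce_reduced s : reduced (reduce s).
Proof. exact: pushs_reduced. Qed.

Lemma push_id a s : reduced (a :: s) -> push a s = a :: s.
Proof. by case: s => //= b s /andP[/negbTE-> _]. Qed.

Lemma reduce_id s : reduced s -> reduce s = s.
Proof.
elim: s => //= a s IH Hs; have Hs' := reduced_behead Hs.
by rewrite -/(reduce s) (IH Hs') push_id.
Qed.

Lemma push_linv a s : reduced s -> push (linv a) (push a s) = s.
Proof.
case: s => [|b s] /= Hs; first by rewrite linvK eqxx.
case: eqP => [Eb|_]; first by rewrite -Eb push_id.
by rewrite /= linvK eqxx.
Qed.

Lemma pushs_cat s t u : pushs (s ++ t) u = pushs s (pushs t u).
Proof. exact: foldr_cat. Qed.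

Lemma pushs_push a s u :
  reduced u -> pushs (push a s) u = push a (pushs s u).
Proof.
move=> Hu; case: s => [|b s] //=; case: eqP => [->|//].
by have:= push_linv (linv a) (pushs_reduced s Hu); rewrite linvK.
Qed.

Lemma pushs_reduce s u : reduced u -> pushs (reduce s) u = pushs s u.
Proof. by move=> Hu; elim: s => //= a s IH; rewrite pushs_push // IH. Qed.

Lemma reduce_cat s t : reduce (s ++ t) = pushs s (reduce t).
Proof. exact: pushs_cat. Qed.

Lemma reduce_catl s t : reduce (reduce s ++ t) = reduce (s ++ t).
Proof. by rewrite !reduce_cat pushs_reduce ?reduce_reduced. Qed.

Lemma reduce_catr s t : reduce (s ++ reduce t) = reduce (s ++ t).
Proof. by rewrite !reduce_cat (reduce_id (reduce_reduced t)). Qed.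

Lemma winv_cons a s : winv (a :: s) = winv s ++ [:: linv a].
Proof. by rewrite /winv /= rev_cons cats1. Qed.

Lemma winvK : involutive winv.
Proof.
by move=> s; rewrite /winv map_rev revK -map_comp map_id_in // => a _ /=;
  apply: linvK.
Qed.

Lemma reduce_winvl s : reduce (winv s ++ s) = [::].
Proof.
elim: s => // a s IH; rewrite winv_cons -catA reduce_cat /=.
by rewrite -/(reduce s) push_linv ?reduce_reduced // -reduce_cat.
Qed.

Lemma reduce_winvr s : reduce (s ++ winv s) = [::].
Proof. by rewrite -{1}(winvK s) reduce_winvl. Qed.

End Words.

(* The free group on X, an element being given by its unique reduced word. *)
Record freegroup (X : choiceType) := FreeGroup {
  fword :> seq (letter X);
  fwordP : reduced fword
}.

HB.instance Definition _ X := [isSub for @fword X].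
HB.instance Definition _ X := [Choice of freegroup X by <:].

Section FreeGroup.
Variable X : choiceType.
Implicit Types u v w : freegroup X.

Definition fg_of_word (s : seq (letter X)) : freegroup X :=
  FreeGroup (reduce_reduced s).
Definition fg_one : freegroup X := @FreeGroup X [::] isT.
Definition fg_mul u v := fg_of_word (u ++ v).
Definition fg_inv u := fg_of_word (winv u).

Lemma fg_mulA : associative fg_mul.
Proof.
by move=> u v w; apply: val_inj; rewrite /= reduce_catl reduce_catr catA.
Qed.
Lemma fg_mul1g : left_id fg_one fg_mul.
Proof. by move=> u; apply: val_inj; rewrite /= reduce_id ?fwordP. Qed.
Lemma fg_mulg1 : right_id fg_one fg_mul.
Proof. by move=> u; apply: val_inj; rewrite /= cats0 reduce_id ?fwordP. Qed.
Lemma fg_mulVg : left_inverse fg_one fg_inv fg_mul.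
Proof. by move=> u; apply: val_inj; rewrite /= reduce_catl reduce_winvl. Qed.
Lemma fg_mulgV : right_inverse fg_one fg_inv fg_mul.
Proof. by move=> u; apply: val_inj; rewrite /= reduce_catr reduce_winvr. Qed.

HB.instance Definition _ :=
  isGroup.Build (freegroup X) fg_mulA fg_mul1g fg_mulg1 fg_mulVg fg_mulgV.

Definition fg_gen (x : X) : freegroup X := @FreeGroup X [:: (x, false)] isT.

End FreeGroup.

Section Evaluation.
Local Open Scope group_scope.

Definition letter_eval (X : choiceType) (G : groupType) (f : X -> G)
  (a : letter X) : G := if a.2 then (f a.1)^-1 else f a.1.

Definition word_eval (X : choiceType) (G : groupType) (f : X -> G)
  (s : seq (letter X)) : G := \prod_(a <- s) letter_eval f a.

Definition represents (X : choiceType) (s : seq (letter X)) (w : freegroup X) :=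
  word_eval (@fg_gen X) s = w.

Definition fg_lift (X : choiceType) (G : groupType) (f : X -> G)
  (w : freegroup X) : G := word_eval f w.

Variables (X : choiceType) (G : groupType) (f : X -> G).

Lemma letter_eval_linv a : letter_eval f (linv a) = (letter_eval f a)^-1.
Proof. by case: a => x []; rewrite /letter_eval /= ?invgK. Qed.

Lemma word_eval_cat s t : word_eval f (s ++ t) = word_eval f s * word_eval f t.
Proof. by rewrite /word_eval big_cat. Qed.

Lemma word_eval_cons a s :
  word_eval f (a :: s) = letter_eval f a * word_eval f s.
Proof. by rewrite /word_eval big_cons. Qed.

Lemma word_eval_push a s : word_eval f (push a s) = word_eval f (a :: s).
Proof.
case: s => //= b s; case: eqP => // ->.
by rewrite !word_eval_cons letter_eval_linv mulgA mulgV mul1g.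
Qed.

Lemma word_eval_reduce s : word_eval f (reduce s) = word_eval f s.
Proof.
elim: s => //= a s IH.
by rewrite word_eval_push !word_eval_cons -/(reduce s) IH.
Qed.

Lemma fg_liftM : {morph fg_lift f : u v / u * v}.
Proof. by move=> u v; rewrite /fg_lift word_eval_reduce word_eval_cat. Qed.

Lemma fg_lift1 : fg_lift f 1 = 1.
Proof. exact: big_nil. Qed.

HB.instance Definition _ :=
  isUMagmaMorphism.Build (freegroup X) G (fg_lift f) (conj fg_lift1 fg_liftM).

Lemma fg_lift_gen x : fg_lift f (fg_gen x) = f x.
Proof. by rewrite /fg_lift /word_eval big_seq1. Qed.

End Evaluation.

Section Universal.
Local Open Scope group_scope.

Lemma word_eval_gen (X : choiceType) (s : seq (letter X)) :
  word_eval (@fg_gen X) s = fg_of_word s.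
Proof.
elim: s => [|a s IH]; first by rewrite /word_eval big_nil; apply: val_inj.
rewrite word_eval_cons IH; apply: val_inj => /=; rewrite reduce_catr.
by case: a => x [].
Qed.

Lemma represents_reduce (X : choiceType) (s : seq (letter X)) w :
  represents s w <-> reduce s = w.
Proof.
by rewrite /represents word_eval_gen; split=> [<-|E] //; apply: val_inj.
Qed.

Lemma fg_lift_unique (X : choiceType) (G : groupType)
    (h : UMagmaMorphism.type (freegroup X) G) w :
  h w = fg_lift (fun x => h (fg_gen x)) w.
Proof.
have Ew: word_eval (@fg_gen X) w = w.
  by rewrite word_eval_gen; apply: val_inj; rewrite /= reduce_id ?fwordP.
rewrite -{1}Ew /fg_lift; elim: (fword w) => [|a s IH].
  by rewrite /word_eval !big_nil gmulf1.
rewrite !word_eval_cons gmulfM IH; congr (_ * _).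
by case: a => x []; rewrite /letter_eval /= ?gmulfV.
Qed.

End Universal.

Local Open Scope ring_scope.

(* Inverses are given by adjugates, so R need not have computable units. *)
Record SL (n : nat) (R : comNzRingType) := SLof {
  SLmx :> 'M[R]_n;
  SL_det : \det SLmx == 1
}.

HB.instance Definition _ n R := [isSub for @SLmx n R].
HB.instance Definition _ n R := [Choice of SL n R by <:].

Section SLGroup.
Variables (n : nat) (R : comNzRingType).
Implicit Types A B : SL n R.

Lemma SL_one_subproof : \det (1%:M : 'M[R]_n) == 1.
Proof. by rewrite det1. Qed.
Lemma SL_mul_subproof A B : \det (A *m B) == 1.
Proof. by rewrite det_mulmx (eqP (SL_det A)) (eqP (SL_det B)) mulr1. Qed.
Lemma SL_inv_subproof A : \det (\adj A) == 1.
Proof.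
have : \det (A *m \adj A) = 1 by rewrite mul_mx_adj (eqP (SL_det A)) det1.
by rewrite det_mulmx (eqP (SL_det A)) mul1r => ->.
Qed.

Definition SL_one := SLof SL_one_subproof.
Definition SL_mul A B := SLof (SL_mul_subproof A B).
Definition SL_inv A := SLof (SL_inv_subproof A).

Lemma SL_mulA : associative SL_mul.
Proof. by move=> A B C; apply: val_inj; apply: mulmxA. Qed.
Lemma SL_mul1g : left_id SL_one SL_mul.
Proof. by move=> A; apply: val_inj; apply: mul1mx. Qed.
Lemma SL_mulg1 : right_id SL_one SL_mul.
Proof. by move=> A; apply: val_inj; apply: mulmx1. Qed.
Lemma SL_mulVg : left_inverse SL_one SL_inv SL_mul.
Proof.
by move=> A; apply: val_inj; rewrite /= mul_adj_mx (eqP (SL_det A)).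
Qed.
Lemma SL_mulgV : right_inverse SL_one SL_inv SL_mul.
Proof.
by move=> A; apply: val_inj; rewrite /= mul_mx_adj (eqP (SL_det A)).
Qed.

HB.instance Definition _ :=
  isGroup.Build (SL n R) SL_mulA SL_mul1g SL_mulg1 SL_mulVg SL_mulgV.

End SLGroup.

Definition mx2 (R : comNzRingType) (a b c d : R) : 'M[R]_2 :=
  \matrix_(i, j) if i == 0 then (if j == 0 then a else b)
                 else (if j == 0 then c else d).

Lemma det_mx2 (R : comNzRingType) (a b c d : R) :
  \det (mx2 a b c d) = a * d - b * c.
Proof.
rewrite (expand_det_row _ 0) big_ord_recl big_ord1 /cofactor !det_mx11 !mxE /=.
by rewrite expr0 expr1 mul1r mulN1r mulrN.
Qed.

Lemma SL_upper_subproof (R : comNzRingType) : \det (mx2 1 2 0 (1 : R)) == 1.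
Proof. by rewrite det_mx2 mulr1 mulr0 subr0. Qed.
Lemma SL_lower_subproof (R : comNzRingType) : \det (mx2 1 0 2 (1 : R)) == 1.
Proof. by rewrite det_mx2 mulr1 mul0r subr0. Qed.

Definition SL_upper (R : comNzRingType) : SL 2 R := SLof (SL_upper_subproof R).
Definition SL_lower (R : comNzRingType) : SL 2 R := SLof (SL_lower_subproof R).

Definition F2 : groupType := freegroup 'I_2.

Definition F2_to_SL2 (p : nat) : UMagmaMorphism.type F2 (SL 2 'F_p) :=
  fg_lift (fun i : 'I_2 => if i == 0 then SL_upper 'F_p else SL_lower 'F_p).

Lemma F2_to_SL2_gen0 p : F2_to_SL2 p (fg_gen 0) = SL_upper 'F_p.
Proof. exact: fg_lift_gen. Qed.
Lemma F2_to_SL2_gen1 p : F2_to_SL2 p (fg_gen 1) = SL_lower 'F_p.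
Proof. exact: fg_lift_gen. Qed.

(* Main.v *)
Require Import Defs.
From mathcomp Require Import all_boot all_order all_algebra all_fingroup.
From mathcomp Require Import zify ring.

(** Let w be a nonempty reduced word, acting by integer matrices. A ping-pong
   argument applied to a standard basis vector produces an off-diagonal matrix
   entry x <> 0, and |x| <= 3 ^ n. If w dies modulo every prime p <= N, then
   every such p divides x. On the other hand every prime power dividing
   'C(N, i) is at most N, and a prime p > sqrt N divides it at most once, so
   'C(N, i) <= N ^ (sqrt N) * |x|; summing over i gives
   2 ^ N <= (N + 1) * N ^ (sqrt N) * 3 ^ n, which is false for N a large
   multiple of n. Taking N to be a power of 4 makes sqrt N exact. *)

Set Implicit Arguments.
Unset Strict Implicit.
Unset Printing Implicit Defensive.

Import Order.TTheory GRing.Theory Num.Theory.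

(** * Prime powers dividing binomial coefficients *)

(** The extra terms vanish since [m < k < p ^ k]. A range independent of [m] lets the sums for [m],
    [n - m] and [n] be compared term by term. *)
Lemma logn_fact_widen p m n :
  prime p -> m <= n -> logn p m`! = \sum_(1 <= k < n.+1) m %/ p ^ k.
Proof.
move=> p_pr le_mn; rewrite logn_fact // [RHS](big_cat_nat (n := m.+1)) //=.
rewrite [X in _ = _ + X]big_nat_cond [X in _ = _ + X]big1 ?addn0 // => k.
rewrite andbT => /andP[lt_mk _]; rewrite divn_small //.
exact: ltn_trans lt_mk (ltn_expl _ (prime_gt1 p_pr)).
Qed.

(* By Legendre's formula the exponent counts the carries when adding m and
   n - m in base p, and a carry into position k requires p ^ k <= n. *)
Lemma leq_logn_bin p n m : prime p -> logn p 'C(n, m) <= trunc_log p n.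
Proof.
move=> p_pr; have [lt_nm|le_mn] := ltnP n m; first by rewrite bin_small ?logn0.
have p_gt1 := prime_gt1 p_pr.
have := congr1 (logn p) (bin_fact le_mn).
rewrite !lognM ?muln_gt0 ?fact_gt0 ?bin_gt0 //.
rewrite (@logn_fact_widen p m n) // (@logn_fact_widen p (n - m) n) ?leq_subr //.
rewrite (@logn_fact_widen p n n) // -big_split /= => E.
(* Splitting [n] costs each quotient at most 1, and the quotient of [n] is 0 once [p ^ k] exceeds
   [n]. *)
have : \sum_(1 <= k < n.+1) n %/ p ^ k <=
   \sum_(1 <= k < n.+1) (m %/ p ^ k + (n - m) %/ p ^ k) +
   \sum_(1 <= k < n.+1) (k <= trunc_log p n).
  rewrite -big_split /= leq_sum // => k _.
  have [le_kT|lt_Tk] := leqP k (trunc_log p n).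
    by rewrite -{1}(subnKC le_mn) leq_divDl.
  rewrite [n %/ _]divn_small // (leq_trans (trunc_log_ltn n p_gt1)) //.
  by rewrite leq_exp2l.
rewrite -E addnC leq_add2l => /leq_trans; apply.
have [//|lt_nT] := leqP (trunc_log p n) n; last first.
  have := ltn_expl (trunc_log p n) p_gt1; have := @trunc_logP p n p_gt1.
  by move: lt_nT; case: n {le_mn E} => [|n]; [rewrite trunc_log0 | lia].
move=> le_Tn; rewrite (big_cat_nat (n := (trunc_log p n).+1)) //=.
rewrite [X in _ + X]big_nat_cond [X in _ + X]big1 ?addn0; last first.
  by move=> k /andP[/andP[lt_Tk _] _]; rewrite leqNgt lt_Tk.
rewrite big_nat_cond (leq_trans (n := \sum_(1 <= k < (trunc_log p n).+1) 1)) //.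
  by rewrite [X in _ <= X]big_nat_cond; apply: leq_sum => k _; apply: leq_b1.
by rewrite sum_nat_const_nat muln1 subn1.
Qed.

Lemma leq_pfactor_bin p n m : prime p -> 0 < n -> p ^ logn p 'C(n, m) <= n.
Proof.
move=> p_pr n_gt0; have p_gt1 := prime_gt1 p_pr.
apply: leq_trans (@trunc_logP p n p_gt1 n_gt0).
by rewrite leq_exp2l // leq_logn_bin.
Qed.

Lemma logn_bin_le1 p n m : prime p -> n < p ^ 2 -> logn p 'C(n, m) <= 1.
Proof.
move=> p_pr lt_np2; apply: leq_trans (leq_logn_bin n m p_pr) _.
case: n lt_np2 => [|n] lt_np2; first by rewrite trunc_log0.
have p_gt1 := prime_gt1 p_pr; rewrite -ltnS -(ltn_exp2l _ _ p_gt1).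
exact: leq_ltn_trans (@trunc_logP p n.+1 p_gt1 isT) lt_np2.
Qed.

(** Compare prime by prime: each [p <= r] is paid for by a factor [r ^ 2], a prime between [r] and
    [r ^ 2] occurs at most once and divides [x], and larger primes do not occur. *)
Lemma leq_bin_sqr r i x :
  0 < r -> 0 < x -> (forall p, prime p -> p <= r ^ 2 -> p %| x) ->
  'C(r ^ 2, i) <= (r ^ 2) ^ r * x.
Proof.
set N := r ^ 2 => r_gt0 x_gt0 dvd_x.
have N_gt0 : 0 < N by rewrite expn_gt0 r_gt0.
have le_rN : r <= N by rewrite -[leqLHS]muln1 leq_mul.
have [lt_Ni|le_iN] := ltnP N i; first by rewrite bin_small.
have C_gt0 : 0 < 'C(N, i) by rewrite bin_gt0.
(* A common range for both factorizations; [logn] is 0 at nonprimes, which therefore contribute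
   1. *)
pose M := maxn x 'C(N, i) + N.
have prodE y : 0 < y -> y <= M -> y = \prod_(0 <= p < M.+1) p ^ logn p y.
  move=> y_gt0 le_yM; rewrite -{1}(@part_pnat_id [pred p | true] y).
    by rewrite (@widen_partn M).
  by rewrite /pnat y_gt0; apply/allP.
rewrite [leqLHS]prodE // ?/M ?leq_maxr; last by lia.
rewrite [x in _ * x]prodE //; last by rewrite /M; lia.
(* One factor [N] for each index from 1 to [r], prime or not. *)
have -> : N ^ r = \prod_(0 <= p < M.+1) if 0 < p <= r then N else 1.
  rewrite (big_cat_nat (n := r.+1)) //=; last by rewrite /M; lia.
  rewrite [X in _ * X]big_nat_cond [X in _ * X]big1 ?muln1; last first.
    by move=> p /andP[/andP[lt_rp _] _]; rewrite [p <= r]leqNgt lt_rp andbF.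
  rewrite big_nat_recl //= mul1n.
  rewrite big_nat_cond (eq_bigr (fun=> N)); last by move=> p /andP[/andP[_ ->]].
  by rewrite -big_nat_cond prod_nat_const_nat subn0.
rewrite -big_split /=; apply: leq_prod => p _.
have [p_pr|p_npr] := boolP (prime p); last first.
  by rewrite [logn p 'C(_, _)]lognE [logn p x]lognE (negbTE p_npr) muln1 /=;
     case: ifP.
have p_gt0 := prime_gt0 p_pr; rewrite p_gt0 /=.
have [le_pr|lt_rp] := leqP p r.
  apply: leq_trans (leq_pfactor_bin i p_pr N_gt0) _.
  by rewrite leq_pmulr // expn_gt0 p_gt0.
rewrite mul1n leq_exp2l ?prime_gt1 //.
have [le_pN|lt_Np] := leqP p N.
  apply: leq_trans (logn_bin_le1 i p_pr _) _; first by rewrite ltn_exp2r.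
  by rewrite logn_gt0 mem_primes p_pr x_gt0 dvd_x.
apply: leq_trans (leq_logn_bin N i p_pr) _.
suff -> : trunc_log p N = 0 by [].
by apply/eqP; rewrite trunc_log_eq0; apply/orP; right; lia.
Qed.

Lemma leq_exp2_sqr r x :
  0 < r -> 0 < x -> (forall p, prime p -> p <= r ^ 2 -> p %| x) ->
  2 ^ (r ^ 2) <= (r ^ 2).+1 * ((r ^ 2) ^ r * x).
Proof.
move=> r_gt0 x_gt0 dvd_x; rewrite -[2]/(1 + 1) expnDn.
rewrite -[X in X * _]card_ord -sum_nat_const; apply: leq_sum => i _.
by rewrite !exp1n !muln1 leq_bin_sqr.
Qed.

(** * Ping-pong for the action on pairs of integers *)

Section SL2Action.
Local Open Scope ring_scope.

Definition letter_sign (R : pzRingType) (a : letter 'I_2) : R := (-1) ^+ a.2.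

Definition letter_act (R : pzRingType) (a : letter 'I_2) (v : R * R) : R * R :=
  if a.1 == 0 then (v.1 + 2 * letter_sign R a * v.2, v.2)
  else (v.1, v.2 + 2 * letter_sign R a * v.1).

Definition word_act (R : pzRingType) (s : seq (letter 'I_2)) (v : R * R) :=
  foldr (@letter_act R) v s.

Definition mxcol (R : pzRingType) (v : R * R) : 'cV[R]_2 :=
  \col_i if i == 0 then v.1 else v.2.

Lemma mxcol_inj (R : pzRingType) : injective (@mxcol R).
Proof.
move=> [x y] [x' y'] /matrixP E; have := E 0 0; have := E 1 0.
by rewrite !mxE /= => -> ->.
Qed.

Definition SL2_gen (R : comNzRingType) (i : 'I_2) : SL 2 R :=
  if i == 0 then SL_upper R else SL_lower R.

Lemma mul_gen_col (R : comNzRingType) i (v : R * R) :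
  SL2_gen R i *m mxcol v = mxcol (letter_act (i, false) v).
Proof.
rewrite /SL2_gen /letter_act /letter_sign /=.
by case: (i == 0); apply/matrixP => j k;
  rewrite !mxE big_ord_recl big_ord1 !mxE /=;
  case: j => [[|[|j]] Hj] //=; rewrite ?mulr1 ?mul1r ?mul0r ?addr0 ?add0r //;
  rewrite addrC.
Qed.

Lemma letter_act_linv (R : comNzRingType) i (v : R * R) :
  letter_act (i, false) (letter_act (i, true) v) = v.
Proof.
case: v => x y; rewrite /letter_act /letter_sign /=.
by case: (i == 0) => /=; congr (_, _); ring.
Qed.

Lemma mul_letter_col (R : comNzRingType) a (v : R * R) :
  letter_eval (@SL2_gen R) a *m mxcol v = mxcol (letter_act a v).
Proof.
case: a => i []; rewrite /letter_eval /=; last exact: mul_gen_col.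
rewrite -{1}[v](letter_act_linv i) -mul_gen_col mulmxA.
have /= -> := congr1 (@SLmx 2 R) (mulVg (SL2_gen R i)).
exact: mul1mx.
Qed.

Lemma mul_word_col (R : comNzRingType) s (v : R * R) :
  word_eval (@SL2_gen R) s *m mxcol v = mxcol (word_act s v).
Proof.
elim: s => [|a s IHs]; first by rewrite /word_eval big_nil mul1mx.
by rewrite word_eval_cons -mulmxA IHs mul_letter_col.
Qed.

Lemma word_act_intr (R : pzRingType) s (v : int * int) :
  word_act s (v.1%:~R : R, v.2%:~R) =
  ((word_act s v).1%:~R, (word_act s v).2%:~R).
Proof.
elim: s => //= a s ->; rewrite /letter_act /letter_sign.
by case: (a.1 == 0); rewrite /= !rmorphD /= !rmorphM /= rmorph_sign.
Qed.

(** The dominant coordinate identifies the generator, and the sign of the product separates it from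
    its inverse. Strict positivity keeps both coordinates nonzero. *)
Definition pingpong_region (a : letter 'I_2) (v : int * int) :=
  if a.1 == 0 then (`|v.2| < `|v.1|) && (0 < letter_sign int a * v.1 * v.2)
  else (`|v.1| < `|v.2|) && (0 < letter_sign int a * v.1 * v.2).

(** If [a] and [b] involve different generators, twice the dominant coordinate is added to the
    smaller one; if [b = a], the signs agree and nothing cancels. *)
Lemma letter_act_region a b (v : int * int) :
  b != linv a -> pingpong_region b v -> pingpong_region a (letter_act a v).
Proof.
case: a b v => [i d] [j e] [x y].
rewrite /pingpong_region /letter_act /linv /letter_sign /=.
rewrite xpair_eqE.
have E (k : 'I_2) : k = 0 \/ k = 1.
  by case: k => [[|[|k]] Hk] //; [left|right]; apply: val_inj.
by case: (E i) (E j) => -> [] ->; case: d; case: e => //= _ /andP[? ?]; apply/andP; split; nia.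
Qed.

Lemma word_act_region a s (v : int * int) :
  reduced (a :: s) -> pingpong_region (last a s) (letter_act (last a s) v) ->
  pingpong_region a (word_act (a :: s) v).
Proof.
elim: s a => [|b s IHs] a //= /andP[ba red_bs] last_v.
exact: letter_act_region ba (IHs b red_bs last_v).
Qed.

(** A letter adds twice one coordinate to the other, so it at most triples the sum of absolute
    values. *)
Lemma word_act_bound s (v : int * int) :
  `|(word_act s v).1| + `|(word_act s v).2| <=
  (3 ^ size s)%:Z * (`|v.1| + `|v.2|).
Proof.
elim: s => [|a s IHs] /=; first by rewrite mul1r.
rewrite expnS PoszM -mulrA; set w := word_act s v in IHs *.
apply: le_trans (_ : 3 * (`|w.1| + `|w.2|) <= _); last by rewrite ler_pM2l.
rewrite /letter_act /letter_sign; case: a => i [] /=; case: (i == 0) => /=; lia.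
Qed.

Lemma reduced_coordinate (s : seq (letter 'I_2)) : reduced s -> s != [::] ->
  exists x : int, [/\ x != 0, `|x| <= (3 ^ size s)%:Z &
    forall R : comNzRingType, word_eval (@SL2_gen R) s = 1%g -> x%:~R = 0 :> R].
Proof.
case: s => // a s red_s _.
have act1 (R : comNzRingType) (v : R * R) :
    word_eval (@SL2_gen R) (a :: s) = 1%g -> word_act (a :: s) v = v.
  by move=> E; have := mul_word_col (a :: s) v; rewrite E mul1mx => /mxcol_inj.
(* The basis vector moved by the last letter. It lies in no region itself, but its image does. *)
pose v : int * int := if (last a s).1 == 0 then (0, 1) else (1, 0).
have reg : pingpong_region (last a s) (letter_act (last a s) v).
  rewrite /v /pingpong_region /letter_act /letter_sign.
  by case: ((last a s).1 == 0); case: (last a s).2.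
have := word_act_region red_s reg; have := word_act_bound (a :: s) v.
have := fun R : comNzRingType => word_act_intr R (a :: s) v.
case E : (word_act (a :: s) v) => [x y] intr_act /= bound.
rewrite /pingpong_region /= => reg_a.
have [x0 y0] : x != 0 /\ y != 0.
  by move: reg_a; case: ifP => _ /andP[_ pos]; split; apply/eqP => E0;
    move: pos; rewrite E0 ?mulr0 ?mul0r.
move: bound intr_act; rewrite /v.
(* The witness is the coordinate that is 0 in [v]: a word acting trivially over [R] sends it back to
   0. *)
case: ((last a s).1 == 0) => /= bound intr_act; [exists x | exists y]; split=> //.
- lia.
- by move=> R E1; have [] := etrans (esym (act1 R (0, 1) E1)) (intr_act R).
- lia.
- by move=> R E1; have [] := etrans (esym (act1 R (1, 0) E1)) (intr_act R).
Qed.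

End SL2Action.

(** * Numerical estimates and choice of the prime *)

Lemma size_reduce (X : choiceType) (s : seq (letter X)) :
  size (reduce s) <= size s.
Proof.
elim: s => //= a s; rewrite -/(reduce s); case: (reduce s) => [|b t] //=.
by case: ifP => _ /= ?; lia.
Qed.

Lemma mul8_leq_exp2 k : 5 < k -> 8 * k <= 2 ^ k.
Proof.
elim: k => // k IHk; rewrite ltnS leq_eqVlt => /predU1P[<- //|lt5k].
by rewrite expnS; have := IHk lt5k; lia.
Qed.

(** With [t = 2 ^ k] and [3 ^ n <= 4 ^ n], comparing exponents of 2 leaves
    [2k + 1 + 2kt + 2n < t ^ 2], where [8 * k <= t] and [1024 * n < t ^ 2]. *)
Lemma ltn_exp2_sqr n k : 0 < n -> 1024 * n < 4 ^ k ->
  ((2 ^ k) ^ 2).+1 * (((2 ^ k) ^ 2) ^ (2 ^ k) * 3 ^ n) < 2 ^ ((2 ^ k) ^ 2).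
Proof.
move=> n_gt0 lt_n4k.
(* Here [1024 = 4 ^ 5], and 6 is where [8 * k <= 2 ^ k] starts to hold. *)
have lt5k : 5 < k by rewrite -(@ltn_exp2l 4) //; apply: leq_ltn_trans lt_n4k; lia.
have le8k := mul8_leq_exp2 lt5k.
have E4 : 4 ^ k = (2 ^ k) ^ 2 by rewrite -expnM mulnC expnM.
rewrite -[X in X.+1 * _]expnM -[X in X ^ _ * _]expnM.
have leN : (2 ^ (k * 2)).+1 <= 2 ^ (k * 2).+1.
  by rewrite expnS; have := expn_gt0 2 (k * 2); lia.
have le3 : 3 ^ n <= 2 ^ (2 * n) by rewrite expnM leq_exp2r.
apply: leq_ltn_trans (leq_mul leN (leq_mul (leqnn _) le3)) _.
rewrite -expnM -!expnD ltn_exp2l //.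
by move: lt_n4k; rewrite E4; set t := 2 ^ k in le8k *; nia.
Qed.

Theorem theorem6p7 :
  exists c : nat,
  forall (w : F2) (n : nat) (s : seq (letter 'I_2)),
    w <> 1%g -> represents s w -> size s = n ->
    exists p : nat, [/\ prime p, p <= c * n & F2_to_SL2 p w <> 1%g].
Proof.
(* The least power of 4 above [1024 * n] is at most [4 * 1024 * n]. *)
exists 4096 => w n s w_neq1 /represents_reduce def_w size_s.
have w_nil : fword w != [::].
  by apply/eqP => w0; apply: w_neq1; apply: val_inj.
have size_w : size (fword w) <= n by rewrite -def_w -size_s size_reduce.
have n_gt0 : 0 < n by case: (fword w) w_nil size_w => //= a t _; lia.
have [x [x_neq0 x_le x_ker]] := reduced_coordinate (fwordP w) w_nil.
set k := (trunc_log 4 (1024 * n)).+1.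
have lt_n4k : 1024 * n < 4 ^ k by apply: trunc_log_ltn.
have le_4kn : 4 ^ k <= 4096 * n.
  rewrite /k expnS (_ : 4096 * n = 4 * (1024 * n)) ?leq_pmul2l //; last by lia.
  by apply: trunc_logP => //; lia.
have E4 : 4 ^ k = (2 ^ k) ^ 2 by rewrite -expnM mulnC expnM.
have [/existsP[p /andP[p_pr /eqP p_w]]|] :=
  boolP [exists p : 'I_(4 ^ k).+1, prime p && (F2_to_SL2 p w != 1%g)].
  by exists p; split=> //; apply: leq_trans le_4kn; rewrite -ltnS.
rewrite negb_exists => /forallP all_ker; exfalso.
have dvd_x p : prime p -> p <= (2 ^ k) ^ 2 -> p %| `|x|%N.
  rewrite -E4 -ltnS => p_pr lt_p; have := all_ker (Ordinal lt_p).
  rewrite /= p_pr negbK => /eqP /x_ker x0.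
  rewrite (dvdn_pcharf (pchar_Fp p_pr)).
  (* For negative [x], the absolute value is [- x], whose image also vanishes. *)
  case: (x) x0 => m /= x0; first by rewrite -x0.
  by rewrite -oppr_eq0 -[(- _)%R]/((Negz m)%:~R)%R x0.
have x_gt0 : 0 < `|x|%N by rewrite absz_gt0.
have le_x : `|x|%N <= 3 ^ n.
  by move: x_le; rewrite -abszE lez_nat => /leq_trans; apply; rewrite leq_exp2l.
have := leq_exp2_sqr (expn_gt0 2 k) x_gt0 dvd_x.
rewrite leqNgt => /negP; apply; apply: leq_ltn_trans (ltn_exp2_sqr n_gt0 lt_n4k).
by rewrite !leq_mul.
Qed.
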